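(* For a morphism $f:M\to N$ of $\mathbb B$-modules, the natural map from $\mathrm{Coim}\,f$ to $\mathrm{Im}(f)$ is an isomorphism.
   Context: $\mathbb B=\{0,1\}$ is the Boolean semifield ($1+1=1$). A $\mathbb B$-module is a commutative monoid $(M,+,0)$ with $x+x=x$ for all $x$; morphisms are the monoid homomorphisms; the category is denoted $\mathrm{Bmod}$. Finite coproducts and products agree and $M\oplus N=M\times N$. For $f:M\to N$: let $\mathrm{Ker}_p f\subset M\times M$ be the equalizer of $f\circ p_1,f\circ p_2:M\times M\to N$, where $p_1,p_2:M\times M\to M$ are the projections, and let $\iota_1,\iota_2:\mathrm{Ker}_pf\to M$ be the restrictions of $p_1,p_2$. Then $\mathrm{Coim}\,f$ is the coequalizer in $\mathrm{Bmod}$ of $\iota_1,\iota_2$ (a quotient of $M$). Let $s_1,s_2:N\to N\oplus N$ be the canonical inclusions and let $\mathrm{Coker}_pf$ be the coequalizer in $\mathrm{Bmod}$ of $s_1\circ f,s_2\circ f:M\to N\oplus N$; let $\gamma_1,\gamma_2:N\to\mathrm{Coker}_pf$ be the compositions of $s_1,s_2$ with the coequalizer map. Then $\mathrm{Im}(f)\subset N$ is the equalizer of $\gamma_1,\gamma_2$. The natural map $\mathrm{Coim}\,f\to\mathrm{Im}(f)$ is the unique morphism whose composition with the quotient map $M\to\mathrm{Coim}\,f$ and the inclusion $\mathrm{Im}(f)\to N$ is $f$. *)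

(* Defs.v *)
From HB Require Import structures.
From mathcomp Require Import all_boot ssralg.
From mathcomp Require Import boolp.

Set Implicit Arguments.
Unset Strict Implicit.
Unset Printing Implicit Defensive.

Import GRing.Theory.
Local Open Scope ring_scope.

(* The carrier of an nmodType is a choiceType; with the classical axioms of
   boolp every type carries such a structure, so this does not restrict the
   commutative monoids considered. *)
HB.mixin Record isIdempotentNmodule V of GRing.Nmodule V := {
  addbb : forall x : V, x + x = x
}.

#[short(type="bmodType")]
HB.structure Definition BModule :=
  {V of GRing.Nmodule V & isIdempotentNmodule V}.

(* Morphisms of B-modules are the monoid morphisms {additive M -> N}, compared
   with =1. *)
Definition bmod_iso (M N : bmodType) (u : {additive M -> N}) : Prop :=
  exists v : {additive N -> M}, cancel u v /\ cancel v u.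

Definition is_equalizer (M N : bmodType) (f g : {additive M -> N})
    (E : bmodType) (i : {additive E -> M}) : Prop :=
  f \o i =1 g \o i /\
  forall (P : bmodType) (h : {additive P -> M}), f \o h =1 g \o h ->
    exists u : {additive P -> E}, i \o u =1 h /\
      forall v : {additive P -> E}, i \o v =1 h -> v =1 u.

Definition is_coequalizer (M N : bmodType) (f g : {additive M -> N})
    (Q : bmodType) (q : {additive N -> Q}) : Prop :=
  q \o f =1 q \o g /\
  forall (P : bmodType) (h : {additive N -> P}), h \o f =1 h \o g ->
    exists u : {additive Q -> P}, u \o q =1 h /\
      forall v : {additive Q -> P}, v \o q =1 h -> v =1 u.

Section Biproduct.
Variables M N : bmodType.

Fact pair_addbb (x : M * N) : x + x = x.
Proof. by case: x => a b; congr pair; exact: addbb. Qed.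

HB.instance Definition _ :=
  isIdempotentNmodule.Build (M * N)%type pair_addbb.

Definition bmod_inl (x : M) : M * N := (x, 0).
Definition bmod_inr (y : N) : M * N := (0, y).

Fact bmod_inl_nmod_morphism : GRing.nmod_morphism bmod_inl.
Proof. by split=> // x y; congr pair; rewrite addr0. Qed.

Fact bmod_inr_nmod_morphism : GRing.nmod_morphism bmod_inr.
Proof. by split=> // x y; congr pair; rewrite addr0. Qed.

HB.instance Definition _ :=
  GRing.isNmodMorphism.Build M (M * N)%type bmod_inl bmod_inl_nmod_morphism.
HB.instance Definition _ :=
  GRing.isNmodMorphism.Build N (M * N)%type bmod_inr bmod_inr_nmod_morphism.

End Biproduct.

Section Equalizer.
Variables (M N : bmodType) (f g : {additive M -> N}).

Definition eqz_pred : {pred M} := fun x => f x == g x.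

Fact eqz_addr_closed : GRing.nmod_closed eqz_pred.
Proof.
split=> [|x y]; rewrite !unfold_in ?raddf0 //.
by move=> /eqP fgx /eqP fgy; rewrite !raddfD fgx fgy.
Qed.

Definition equalizer := {x : M | eqz_pred x}.

HB.instance Definition _ := SubChoice.on equalizer.
HB.instance Definition _ :=
  GRing.SubChoice_isSubNmodule.Build M eqz_pred equalizer eqz_addr_closed.

Fact equalizer_addbb (x : equalizer) : x + x = x.
Proof. by apply: val_inj; rewrite raddfD addbb. Qed.

HB.instance Definition _ := isIdempotentNmodule.Build equalizer equalizer_addbb.

Definition eqz_incl : {additive equalizer -> M} := (\val : equalizer -> M).

Lemma eqz_inclE (x : equalizer) : f (eqz_incl x) = g (eqz_incl x).
Proof. exact/eqP/(valP x). Qed.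

Section Lift.
Variables (P : bmodType) (h : {additive P -> M}) (fgh : f \o h =1 g \o h).

Fact eqz_lift_subproof (p : P) : eqz_pred (h p).
Proof. exact/eqP/fgh. Qed.

Definition eqz_lift_fun (p : P) : equalizer := exist _ (h p) (eqz_lift_subproof p).

Fact eqz_lift_nmod_morphism : GRing.nmod_morphism eqz_lift_fun.
Proof. by split=> [|x y]; apply: val_inj; rewrite /= ?raddf0 ?raddfD. Qed.

HB.instance Definition _ :=
  GRing.isNmodMorphism.Build P equalizer eqz_lift_fun eqz_lift_nmod_morphism.

Definition eqz_lift : {additive P -> equalizer} := eqz_lift_fun.

Lemma eqz_liftK : eqz_incl \o eqz_lift =1 h.
Proof. by []. Qed.

End Lift.

Lemma equalizerP : is_equalizer f g eqz_incl.
Proof.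
split=> [x|P h fgh]; first exact: eqz_inclE.
exists (eqz_lift fgh); split=> [|v vh p]; first exact: eqz_liftK.
by apply: val_inj; exact: vh.
Qed.

End Equalizer.

Section Coequalizer.
Variables (M N : bmodType) (f g : {additive M -> N}).

(* The smallest congruence on N identifying f x with g x for all x. *)
Inductive coeqz_cong : N -> N -> Prop :=
| CoeqzBase x : coeqz_cong (f x) (g x)
| CoeqzRefl y : coeqz_cong y y
| CoeqzSym y z : coeqz_cong y z -> coeqz_cong z y
| CoeqzTrans y z t : coeqz_cong y z -> coeqz_cong z t -> coeqz_cong y t
| CoeqzAdd y z y' z' : coeqz_cong y z -> coeqz_cong y' z' ->
    coeqz_cong (y + y') (z + z').

Definition coeqz_rel : rel N := fun y z => `[< coeqz_cong y z >].

Fact coeqz_rel_refl : reflexive coeqz_rel.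
Proof. by move=> y; apply/asboolP/CoeqzRefl. Qed.

Fact coeqz_rel_sym : symmetric coeqz_rel.
Proof. by move=> y z; apply/asboolP/asboolP; exact: CoeqzSym. Qed.

Fact coeqz_rel_trans : transitive coeqz_rel.
Proof.
by move=> z y t /asboolP yz /asboolP zt; apply/asboolP/(CoeqzTrans yz zt).
Qed.

Canonical coeqz_equiv :=
  EquivRel coeqz_rel coeqz_rel_refl coeqz_rel_sym coeqz_rel_trans.

Definition coequalizer := {eq_quot coeqz_equiv}%qT.

HB.instance Definition _ := Choice.on coequalizer.
HB.instance Definition _ := EqQuotient.on coequalizer.

Definition coeqz_proj_fun (y : N) : coequalizer := (\pi_coequalizer y)%qT.

Fact coeqz_proj_eqP y z : coeqz_proj_fun y = coeqz_proj_fun z <-> coeqz_cong y z.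
Proof.
by split=> [/eqmodP /asboolP // | yz]; apply/eqmodP/asboolP.
Qed.

Fact coeqz_projP (P : coequalizer -> Prop) :
  (forall y, P (coeqz_proj_fun y)) -> forall q, P q.
Proof. by move=> Ppi q; rewrite -(reprK q); exact: Ppi. Qed.

Definition coeqz_add (q r : coequalizer) : coequalizer :=
  coeqz_proj_fun (repr q + repr r).

Fact coeqz_repr_proj y : coeqz_cong (repr (coeqz_proj_fun y)) y.
Proof. by apply/coeqz_proj_eqP; rewrite /coeqz_proj_fun reprK. Qed.

Fact coeqz_proj_add y z :
  coeqz_add (coeqz_proj_fun y) (coeqz_proj_fun z) = coeqz_proj_fun (y + z).
Proof. by apply/coeqz_proj_eqP/CoeqzAdd; exact: coeqz_repr_proj. Qed.

Fact coeqz_addA : associative coeqz_add.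
Proof.
elim/coeqz_projP=> x; elim/coeqz_projP=> y; elim/coeqz_projP=> z.
by rewrite !coeqz_proj_add addrA.
Qed.

Fact coeqz_addC : commutative coeqz_add.
Proof.
elim/coeqz_projP=> x; elim/coeqz_projP=> y.
by rewrite !coeqz_proj_add addrC.
Qed.

Fact coeqz_add0 : left_id (coeqz_proj_fun 0) coeqz_add.
Proof. by elim/coeqz_projP=> x; rewrite coeqz_proj_add add0r. Qed.

HB.instance Definition _ :=
  GRing.isNmodule.Build coequalizer coeqz_addA coeqz_addC coeqz_add0.

Fact coeqz_proj_nmod_morphism : GRing.nmod_morphism coeqz_proj_fun.
Proof. by split=> // x y; rewrite -coeqz_proj_add. Qed.

HB.instance Definition _ := GRing.isNmodMorphism.Build N coequalizer
  coeqz_proj_fun coeqz_proj_nmod_morphism.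

Fact coequalizer_addbb (q : coequalizer) : q + q = q.
Proof. by elim/coeqz_projP: q => y; rewrite -raddfD addbb. Qed.

HB.instance Definition _ :=
  isIdempotentNmodule.Build coequalizer coequalizer_addbb.

Definition coeqz_proj : {additive N -> coequalizer} := coeqz_proj_fun.

Lemma coeqz_projE x : coeqz_proj (f x) = coeqz_proj (g x).
Proof. exact/coeqz_proj_eqP/CoeqzBase. Qed.

Section Desc.
Variables (P : bmodType) (h : {additive N -> P}) (hfg : h \o f =1 h \o g).

Definition coeqz_desc_fun (q : coequalizer) : P := h (repr q).

Fact coeqz_cong_desc y z : coeqz_cong y z -> h y = h z.
Proof.
elim=> {y z} [x|//|//|y z t _ -> //|y z y' z' _ yz _ yz'].
  exact: hfg.
by rewrite !raddfD yz yz'.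
Qed.

Fact coeqz_desc_proj y : coeqz_desc_fun (coeqz_proj y) = h y.
Proof. exact/coeqz_cong_desc/coeqz_repr_proj. Qed.

Fact coeqz_desc_nmod_morphism : GRing.nmod_morphism coeqz_desc_fun.
Proof.
split; first by rewrite -(raddf0 coeqz_proj) coeqz_desc_proj raddf0.
elim/coeqz_projP=> x; elim/coeqz_projP=> y.
by rewrite -(raddfD coeqz_proj) !coeqz_desc_proj raddfD.
Qed.

HB.instance Definition _ := GRing.isNmodMorphism.Build coequalizer P
  coeqz_desc_fun coeqz_desc_nmod_morphism.

Definition coeqz_desc : {additive coequalizer -> P} := coeqz_desc_fun.

Lemma coeqz_descK : coeqz_desc \o coeqz_proj =1 h.
Proof. exact: coeqz_desc_proj. Qed.

End Desc.

Lemma coequalizerP : is_coequalizer f g coeqz_proj.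
Proof.
split=> [x|P h hfg]; first exact: coeqz_projE.
exists (coeqz_desc hfg); split=> [|v vh]; first exact: coeqz_descK.
by elim/coeqz_projP=> y; rewrite [RHS](coeqz_desc_proj hfg) -vh.
Qed.

End Coequalizer.

Section CoimIm.
Variables (M N : bmodType) (f : {additive M -> N}).

Definition ker_pair : bmodType :=
  equalizer (f \o (@fst M M)) (f \o (@snd M M)).

Definition ker_pair_incl : {additive ker_pair -> M * M} :=
  eqz_incl (f \o (@fst M M)) (f \o (@snd M M)).

Definition ker_pair1 : {additive ker_pair -> M} := @fst M M \o ker_pair_incl.
Definition ker_pair2 : {additive ker_pair -> M} := @snd M M \o ker_pair_incl.

Definition coim : bmodType := coequalizer ker_pair1 ker_pair2.

Definition coim_proj : {additive M -> coim} := coeqz_proj ker_pair1 ker_pair2.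

Definition coker_pair : bmodType :=
  coequalizer (@bmod_inl N N \o f) (@bmod_inr N N \o f).

Definition coker_pair_proj : {additive N * N -> coker_pair} :=
  coeqz_proj (@bmod_inl N N \o f) (@bmod_inr N N \o f).

Definition coker_pair1 : {additive N -> coker_pair} :=
  coker_pair_proj \o @bmod_inl N N.
Definition coker_pair2 : {additive N -> coker_pair} :=
  coker_pair_proj \o @bmod_inr N N.

Definition im : bmodType := equalizer coker_pair1 coker_pair2.

Definition im_incl : {additive im -> N} := eqz_incl coker_pair1 coker_pair2.

Fact coker_pair_comp : coker_pair1 \o f =1 coker_pair2 \o f.
Proof. exact: coeqz_projE. Qed.

Definition to_im : {additive M -> im} := eqz_lift coker_pair_comp.

Fact to_im_ker_pair : to_im \o ker_pair1 =1 to_im \o ker_pair2.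
Proof. by move=> x; apply: val_inj; exact: (eqz_inclE x). Qed.

Definition coim_to_im : {additive coim -> im} := coeqz_desc to_im_ker_pair.

Lemma coim_to_imE : im_incl \o coim_to_im \o coim_proj =1 f.
Proof. by move=> x; exact: (congr1 im_incl (coeqz_desc_proj to_im_ker_pair x)). Qed.

Lemma coim_to_im_unique (u : {additive coim -> im}) :
  im_incl \o u \o coim_proj =1 f -> u =1 coim_to_im.
Proof.
move=> uE; elim/coeqz_projP=> x; apply: val_inj.
exact: etrans (uE x) (esym (coim_to_imE x)).
Qed.

End CoimIm.

(* Main.v *)
(** Injectivity of the natural map is formal.  Surjectivity says that [y] lies in
[f M] whenever [(y, 0)] and [(0, y)] are identified in the cokernel pair.  Order
a B-module by [a <= b] iff [a + b = b], let [I] be the ideal of elements below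
[y] and [J] the ideal of elements below some [f m <= y].  The maps to B with
kernels [I] and [J] agree on [f M], so the property "[a] in [I] and [b] in [J]"
of [(a, b)] is invariant under the congruence that defines the cokernel pair.
It holds for [(y, 0)], hence for [(0, y)]: some [f m] satisfies
[y <= f m <= y]. *)

Require Import Defs.
From HB Require Import structures.
From mathcomp Require Import all_boot ssralg.
From mathcomp Require Import boolp.

Set Implicit Arguments.
Unset Strict Implicit.
Unset Printing Implicit Defensive.

Import GRing.Theory.
Local Open Scope ring_scope.

(** By idempotence, sums are joins for the order. *)
Lemma bmod_sum_le (N : bmodType) (a b y : N) :
  a + b + y = y <-> a + y = y /\ b + y = y.
Proof.
split=> [aby | [ay by_]]; last by rewrite -addrA by_.
by split; rewrite -{1}aby !addrA ?[b + a]addrC -?[a + b + b]addrA Defs.addbb.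
Qed.

(** Separates [(y, 0)] from [(0, y)] in the cokernel pair unless [y] is in the image of [f]. *)
Definition coker_pair_sep (M N : bmodType) (f : {additive M -> N}) (y : N)
    (p : N * N) : Prop :=
  p.1 + y = y /\ exists2 m, f m + y = y & p.2 + f m = f m.

Lemma coker_pair_sepD (M N : bmodType) (f : {additive M -> N}) (y : N)
    (p q : N * N) :
  coker_pair_sep f y (p + q) <-> coker_pair_sep f y p /\ coker_pair_sep f y q.
Proof.
split=> [[/bmod_sum_le [p1y q1y] [m my /bmod_sum_le [p2m q2m]]]|].
  by split; split=> //; exists m.
move=> [[p1y [m my p2m]] [q1y [n ny q2n]]]; split; first exact/bmod_sum_le.
(* [f (m + n)] bounds [f m] and [f n], hence [p.2] and [q.2]. *)
exists (m + n); rewrite raddfD; apply/bmod_sum_le => //.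
by split; [rewrite addrA p2m | rewrite addrCA q2n].
Qed.

Lemma coker_pair_sep_cong (M N : bmodType) (f : {additive M -> N}) (y : N)
    (p q : N * N) :
  coeqz_cong (@bmod_inl N N \o f) (@bmod_inr N N \o f) p q ->
  coker_pair_sep f y p <-> coker_pair_sep f y q.
Proof.
elim=> {p q} [m|//|p q _ IH|p q r _ IHpq _ IHqr|p q p' q' _ IH _ IH'].
(* On a generating pair [(f m, 0)], [(0, f m)] both sides amount to [f m <= y]. *)
- split=> [[/= my _] | [_ [n ny /= mn]]].
    by split; [exact: add0r | exists m; rewrite //= Defs.addbb].
  split; first by rewrite /= -ny addrA mn.
  by exists 0; rewrite raddf0 ?add0r ?addr0.
- by split=> ?; apply/IH.
- by split=> ?; [apply/IHqr/IHpq | apply/IHpq/IHqr].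
- by split=> /coker_pair_sepD [? ?]; apply/coker_pair_sepD; split;
    by [apply/IH | apply/IH'].
Qed.

Lemma coker_pair_eq_image (M N : bmodType) (f : {additive M -> N}) (y : N) :
  coker_pair1 f y = coker_pair2 f y -> exists m, f m = y.
Proof.
move=> /coeqz_proj_eqP /(coker_pair_sep_cong y) [+ _].
case=> [|_ [m my /= ym]]; last by exists m; rewrite -ym addrC.
by split; [exact: Defs.addbb | exists 0; rewrite raddf0 ?add0r //= add0r].
Qed.

(** [(x, y)] is a point of the kernel pair, whose two projections [coim_proj] equalizes. *)
Lemma coim_proj_eq (M N : bmodType) (f : {additive M -> N}) (x y : M) :
  f x = f y -> coim_proj f x = coim_proj f y.
Proof.
move=> /eqP fxy.
exact: (coeqz_projE (ker_pair1 f) (ker_pair2 f) (exist _ (x, y) fxy)).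
Qed.

Lemma coim_to_im_inj (M N : bmodType) (f : {additive M -> N}) :
  injective (coim_to_im f).
Proof.
elim/coeqz_projP=> x; elim/coeqz_projP=> y /(congr1 (im_incl f)) xy.
apply: coim_proj_eq.
exact: etrans (esym (coim_to_imE f x)) (etrans xy (coim_to_imE f y)).
Qed.

Lemma coim_to_im_surj (M N : bmodType) (f : {additive M -> N}) (z : im f) :
  exists q, coim_to_im f q = z.
Proof.
have [m fm] := coker_pair_eq_image (eqz_inclE z).
exists (coim_proj f m); apply: val_inj.
exact: etrans (coim_to_imE f m) fm.
Qed.

(** An inverse map, obtained by choice, inherits additivity from [u]. *)
Lemma bij_bmod_iso (M N : bmodType) (u : {additive M -> N}) :
  injective u -> (forall z, exists q, u q = z) -> bmod_iso u.
Proof.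
move=> u_inj /choice [v uv].
have vu : cancel u v by move=> q; apply: u_inj; exact: uv.
pose vM := GRing.isNmodMorphism.Build N M v (can2_nmod_morphism vu uv).
by exists (HB.pack_for {additive N -> M} v vM).
Qed.

Theorem proposition3p10 (M N : bmodType) (f : {additive M -> N}) :
  bmod_iso (coim_to_im f).
Proof. exact: bij_bmod_iso (@coim_to_im_inj _ _ f) (@coim_to_im_surj _ _ f). Qed.
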